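(* Let $\theta$ be a rotation angle, $p\in[0,1]$ the error probability, and consider the single-qubit channel $\mathcal{N}_{\mathcal Y}=(1-p)\mathcal{R}_Y(\theta)+p\,\mathcal{Y}\circ\mathcal{R}_Y(\theta)$. Let $$\varphi=\arcsin[(1-2p)\sin\theta],\qquad s=\frac12\left(1+(1-2p)\frac{\cos\theta}{\cos\varphi}\right).$$ Then $\mathcal{N}_{\mathcal Y}$ has the optimal decomposition (with respect to the channel extent) $$\mathcal{N}_{\mathcal Y}=s\,\mathcal{R}_Y(\varphi)+(1-s)\,\mathcal{R}_Y(\pi-\varphi)$$ and channel extent $$\Xi(\mathcal{N}_{\mathcal Y})=1+|\sin\varphi|=1+(1-2p)|\sin\theta| .$$
   Context: Channels: $\mathcal{R}_Y(\vartheta)(\cdot)=R_Y(\vartheta)(\cdot)R_Y(\vartheta)^\dagger$ with $R_Y(\vartheta)=e^{-i\vartheta Y/2}$; $\mathcal{Y}(\cdot)=Y(\cdot)Y$. On $n$ qubits let $c_{2j-1}=Z^{\otimes(j-1)}\otimes X\otimes I^{\otimes(n-j)}$ and $c_{2j}=Z^{\otimes(j-1)}\otimes Y\otimes I^{\otimes(n-j)}$, $j=1,\dots,n$. The set $G_n$ of Gaussian unitaries consists of the $n$-qubit unitaries $V$ for which there is $R\in O(2n)$ with $Vc_jV^\dagger=\sum_kR_{j,k}c_k$ for all $j$. The unitary extent of an $n$-qubit unitary $U$ is $\xi(U)=\min\{\|c\|_1^2: U=\sum_{j}c_jK_j,\ K_j\in G_n,\ c_j\in\mathbb{C}\}$ (finite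 sums). For a channel $\mathcal{E}$ that is a convex combination of unitary channels, the channel extent is $\Xi(\mathcal{E})=\min\{\sum_jp_j\xi(V_j):\mathcal{E}=\sum_jp_j\mathcal{V}_j,\ \mathcal{V}_j(\cdot)=V_j(\cdot)V_j^\dagger,\ V_j\text{ unitary},\ p_j\ge0,\ \sum_jp_j=1\}$. A decomposition attaining the minimum is called optimal.
   Formalization: The last formula is false for p > 1/2 with sin θ ≠ 0 (p = 1, θ = π/2 gives 0, not 2); proved instead is 1+|1-2p||sin θ| for all p in [0,1], with the printed form for p ≤ 1/2. Where cos φ = 0, s is undefined and is taken to be 1/2. *)

(* Defs.v *)
From HB Require Import structures.
From mathcomp Require Import all_boot all_order all_algebra.
From mathcomp Require Import all_classical all_reals all_analysis.
From mathcomp Require Import complex.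
From mathcomp Require mxtens.

Set Implicit Arguments.
Unset Strict Implicit.
Unset Printing Implicit Defensive.

Import Order.TTheory GRing.Theory Num.Theory.
Import numFieldNormedType.Exports.

Local Open Scope classical_set_scope.
Local Open Scope ring_scope.
Local Open Scope complex_scope.
Local Open Scope sesquilinear_scope.

(* [xget 0] returns the junk value 0 when [A] has no least element. *)
Definition minimum (R : realType) (A : set R) : R :=
  xget 0 [set x | A x /\ lbound A x].

Definition expmx (K : numFieldType) (n : nat) (A : 'M[K]_n) : 'M[K]_n :=
  lim (series (fun k => (k`!%:R : K)^-1 *: A ^+ k) @ \oo).

Section Pauli.
Variable R : realType.

Definition pauliX : 'M[R[i]]_2 := \matrix_(i, j) (i != j)%:R.

Definition pauliY : 'M[R[i]]_2 :=
  \matrix_(i, j) (if i == j then 0 else if i == 0 then - 'i else 'i).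

Definition pauliZ : 'M[R[i]]_2 :=
  \matrix_(i, j) (if i != j then 0 else if i == 0 then 1 else -1).

Definition rotY (t : R) : 'M[R[i]]_2 :=
  expmx (- ('i * (t / 2)%:C) *: pauliY).

End Pauli.

Definition conj_channel (R : realType) (d : nat) (V M : 'M[R[i]]_d)
  : 'M[R[i]]_d := V *m M *m V ^t*.

Lemma qubit_split (n : nat) (j : 'I_n) :
  (2 ^ j * (2 * 2 ^ (n - j.+1)) = 2 ^ n)%N.
Proof. by rewrite -expnS -expnD -subSn ?ltn_ord // subSS subnKC // ltnW. Qed.

(* Z^{⊗ j} ⊗ P ⊗ I^{⊗ (n - j - 1)}, the qubits being numbered from 0. *)
Definition jw_string (R : realType) (n : nat) (P : 'M[R[i]]_2) (j : 'I_n)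
  : 'M[R[i]]_(2 ^ n) :=
  castmx (qubit_split j, qubit_split j)
    (mxtens.tensmx (mxtens.ntensmx (pauliZ R) j)
      (mxtens.tensmx P (mxtens.ntensmx (1%:M : 'M[R[i]]_2) (n - j.+1)))).

Lemma half_ltn (n : nat) (k : 'I_(2 * n)) : (k./2 < n)%N.
Proof. by rewrite -divn2 ltn_divLR // [(n * 2)%N]mulnC. Qed.

(* The index is shifted by one: [majorana k] is c_{k+1}, hence of X type for
   even k and of Y type for odd k, acting on qubit k./2. *)
Definition majorana (R : realType) (n : nat) (k : 'I_(2 * n))
  : 'M[R[i]]_(2 ^ n) :=
  jw_string (if odd k then pauliY R else pauliX R) (Ordinal (half_ltn k)).

Definition gaussian (R : realType) (n : nat) (V : 'M[R[i]]_(2 ^ n)) : Prop :=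
  V \is unitarymx /\
  exists O : 'M[R]_(2 * n), O *m O^T = 1%:M /\
    forall j, V *m majorana R j *m V ^t* = \sum_k (O j k)%:C *: majorana R k.

Definition gaussian_decomposition (R : realType) (n : nat)
    (U : 'M[R[i]]_(2 ^ n)) (D : seq (R[i] * 'M[R[i]]_(2 ^ n))) : Prop :=
  (forall x, x \in D -> gaussian x.2) /\ U = \sum_(x <- D) x.1 *: x.2.

Definition unitary_extent (R : realType) (n : nat) (U : 'M[R[i]]_(2 ^ n)) : R :=
  minimum [set (\sum_(x <- D) Normc.normc x.1) ^+ 2
          | D in gaussian_decomposition U].

Definition unitary_decomposition (R : realType) (n : nat)
    (E : 'M[R[i]]_(2 ^ n) -> 'M[R[i]]_(2 ^ n))
    (D : seq (R * 'M[R[i]]_(2 ^ n))) : Prop :=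
  [/\ forall x, x \in D -> 0 <= x.1 /\ x.2 \is unitarymx,
      \sum_(x <- D) x.1 = 1 &
      forall M, E M = \sum_(x <- D) x.1%:C *: conj_channel x.2 M].

Definition decomposition_cost (R : realType) (n : nat)
    (D : seq (R * 'M[R[i]]_(2 ^ n))) : R :=
  \sum_(x <- D) x.1 * unitary_extent x.2.

Definition channel_extent (R : realType) (n : nat)
    (E : 'M[R[i]]_(2 ^ n) -> 'M[R[i]]_(2 ^ n)) : R :=
  minimum [set decomposition_cost D | D in unitary_decomposition E].

Definition optimal_decomposition (R : realType) (n : nat)
    (E : 'M[R[i]]_(2 ^ n) -> 'M[R[i]]_(2 ^ n))
    (D : seq (R * 'M[R[i]]_(2 ^ n))) : Prop :=
  unitary_decomposition E D /\
  forall D', unitary_decomposition E D' ->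
    decomposition_cost D <= decomposition_cost D'.

Definition noisy_rotY (R : realType) (theta p : R) (M : 'M[R[i]]_2)
  : 'M[R[i]]_2 :=
  (1 - p)%:C *: conj_channel (rotY theta) M
  + p%:C *: conj_channel (pauliY R) (conj_channel (rotY theta) M).

(* Main.v *)
(* A Gaussian one-qubit unitary conjugates X and Y into their real span, so it
   is diagonal or antidiagonal. Hence a unitary with first row (a, b) has extent
   (|a| + |b|)^2 = 1 + 2 |a| |b|: its diagonal and antidiagonal parts give a
   decomposition, and the triangle inequality on the first row bounds any other.
   For a channel with decomposition (p_j, V_j), the entry (0, 1) of the image of
   |0><0| is the sum of p_j (V_j)_00 conj((V_j)_10), so twice its modulus plus 1
   is a lower bound for the cost. For the noisy rotation this is
   1 + |1 - 2p| |sin theta|, attained by the two rotations of the statement,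
   both of which have extent 1 + |sin phi|. *)
Require Import Defs.
From mathcomp Require Import all_boot all_order all_algebra.
From mathcomp Require Import all_classical all_reals all_analysis.
From mathcomp Require Import complex ring lra.
From mathcomp Require mxtens.

Set Implicit Arguments.
Unset Strict Implicit.
Unset Printing Implicit Defensive.

Import Order.TTheory GRing.Theory Num.Theory.
Import numFieldNormedType.Exports.

Local Open Scope classical_set_scope.
Local Open Scope ring_scope.
Local Open Scope complex_scope.
Local Open Scope sesquilinear_scope.

(** * Two-by-two matrices given by their entries *)

Definition mx2 (T : Type) (a b c d : T) : 'M[T]_2 :=
  \matrix_(i, j) (if i == ord0 then if j == ord0 then a else b
                  else if j == ord0 then c else d).

Lemma mx2P (T : Type) (A B : 'M[T]_2) :
  A ord0 ord0 = B ord0 ord0 -> A ord0 ord_max = B ord0 ord_max ->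
  A ord_max ord0 = B ord_max ord0 -> A ord_max ord_max = B ord_max ord_max ->
  A = B.
Proof.
move=> e1 e2 e3 e4; apply/matrixP => i j.
have H (k : 'I_2) : k = ord0 \/ k = ord_max.
  by case: k => [[|[|[]]]] //= ?; [left|right]; apply: val_inj.
by case: (H i) => ->; case: (H j) => ->.
Qed.

Lemma mx2E (T : Type) (A : 'M[T]_2) :
  A = mx2 (A ord0 ord0) (A ord0 ord_max) (A ord_max ord0) (A ord_max ord_max).
Proof. by apply: mx2P; rewrite mxE. Qed.

Lemma mx2_inj (T : Type) (a b c d a' b' c' d' : T) :
  mx2 a b c d = mx2 a' b' c' d' -> [/\ a = a', b = b', c = c' & d = d'].
Proof.
move=> e; move: (congr1 (fun A : 'M[T]_2 => A ord0 ord0) e)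
  (congr1 (fun A : 'M[T]_2 => A ord0 ord_max) e)
  (congr1 (fun A : 'M[T]_2 => A ord_max ord0) e)
  (congr1 (fun A : 'M[T]_2 => A ord_max ord_max) e).
by rewrite !mxE.
Qed.

Lemma mulmx2 (T : pzSemiRingType) (a b c d a' b' c' d' : T) :
  mx2 a b c d *m mx2 a' b' c' d' =
  mx2 (a * a' + b * c') (a * b' + b * d') (c * a' + d * c') (c * b' + d * d').
Proof.
by apply: mx2P; rewrite !mxE !big_ord_recl big_ord0 !mxE /= addr0.
Qed.

Lemma addmx2 (T : nmodType) (a b c d a' b' c' d' : T) :
  mx2 a b c d + mx2 a' b' c' d' = mx2 (a + a') (b + b') (c + c') (d + d').
Proof. by apply: mx2P; rewrite !mxE. Qed.

Lemma scalemx2 (T : pzSemiRingType) (k a b c d : T) :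
  k *: mx2 a b c d = mx2 (k * a) (k * b) (k * c) (k * d).
Proof. by apply: mx2P; rewrite !mxE. Qed.

Lemma scalarmx2 (T : pzSemiRingType) (k : T) : k%:M = mx2 k 0 0 k.
Proof. by apply: mx2P; rewrite !mxE. Qed.

Lemma adjmx2 (T : numClosedFieldType) (a b c d : T) :
  (mx2 a b c d) ^t* = mx2 (a^*)%R (c^*)%R (b^*)%R (d^*)%R.
Proof. by apply: mx2P; rewrite !mxE. Qed.

(** * The closed form of the rotation about Y *)

Section Exponential.
Variable R : realType.

(* The topology of [expmx] is the one of an abstract [numFieldType]; it is not
   found by inference on the bare type [R[i]]. *)
Definition complex_numField : numFieldType := R[i].

Lemma cvg_real_complex (u : R^nat) (l : R) :
  u @ \oo --> l ->
  (fun n => (u n)%:C : complex_numField) @ \oo --> (l%:C : complex_numField).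
Proof.
move=> /cvgrPdist_lt ul; apply/cvgrPdist_lt => -[e e'].
(* A complex number is positive only if its imaginary part is zero, so the tolerance is in fact
   real. *)
rewrite ltcE /= => /andP[/eqP -> e0].
apply: filterS (ul _ e0) => n.
by rewrite -rmorphB normc_def /= expr0n addr0 sqrtr_sqr ltcR.
Qed.

(** A neighbourhood of a matrix contains a product of neighbourhoods of its entries. There are
    finitely many entries, so the corresponding eventual properties can be intersected. *)
Lemma cvg_mxE (K : numFieldType) (m n : nat) (u : nat -> 'M[K]_(m, n))
    (L : 'M[K]_(m, n)) :
  (forall i j, (fun k => u k i j) @ \oo --> L i j) -> u @ \oo --> L.
Proof.
move=> uL A [P LP PA].
have : \forall k \near \oo, forall i j, P i j (u k i j).
  apply: filter_forall => i; apply: filter_forall => j.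
  exact: (uL i j (P i j) (LP i j)).
by apply: filterS => k Pk; apply: PA.
Qed.

Lemma pauliXE : pauliX R = mx2 0 1 1 0.
Proof. by apply: mx2P; rewrite !mxE. Qed.

Lemma pauliYE : pauliY R = mx2 0 (- 'i) 'i 0.
Proof. by apply: mx2P; rewrite !mxE //= -complexiE. Qed.

(** The generator is the real antisymmetric matrix with entries ∓t/2, whose square is -(t/2)^2 times
    the identity: even powers are diagonal, odd ones antidiagonal. The shape of [a] and [b] is that
    of the terms of [cos_coeff] and [sin_coeff] before division by the factorial. *)
Lemma rotY_generatorX (t : R) (k : nat) :
  (- ('i * (t / 2)%:C) *: pauliY R) ^+ k =
  let a := (~~ odd k)%:R * (-1) ^+ k./2 * (t / 2) ^+ k in
  let b := (odd k)%:R * (-1) ^+ k.-1./2 * (t / 2) ^+ k in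
  mx2 a%:C (- b%:C) b%:C a%:C.
Proof.
have gE : - ('i * (t / 2)%:C) *: pauliY R =
    mx2 0 (- (t / 2)%:C) (t / 2)%:C 0.
  rewrite pauliYE scalemx2 !mulr0 -?complexiE; congr mx2; simpc => //.
elim: k => [|k IH] /=.
  by rewrite expr0 !mul0r !mul1r oppr0 -scalarmx2.
rewrite exprS IH {1}gE -[_ * _]/(_ *m _) mulmx2 /=.
rewrite !mul0r !add0r !addr0 !exprS.
case: (boolP (odd k)) => ok /=; rewrite !(mul0r, mul1r, mulr0, oppr0,
    mulrN, mulNr, opprK).
  (* The extra -1 picked up when passing from an odd power to the next even one. *)
  have -> : uphalf k = k.-1./2.+1 by case: k ok {IH} => //= k; rewrite uphalfE.
  by congr mx2; rewrite -?rmorphM -?rmorphN //= exprS; congr _%:C; ring.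
by congr mx2; rewrite -?rmorphM -?rmorphN //=; congr _%:C; ring.
Qed.

Lemma rotY_seriesE (t : R) (n : nat) :
  series (fun k => (k`!%:R : R[i])^-1 *:
     (- ('i * (t / 2)%:C) *: pauliY R) ^+ k) n =
  mx2 (series (cos_coeff (t / 2)) n)%:C (- (series (sin_coeff (t / 2)) n)%:C)
   (series (sin_coeff (t / 2)) n)%:C (series (cos_coeff (t / 2)) n)%:C.
Proof.
have factC (k : nat) (x : R) : (k`!%:R : R[i])^-1 * x%:C = (x / k`!%:R)%:C.
  by rewrite mulrC -(rmorph_nat (real_complex R)) -fmorphV -rmorphM.
rewrite /series /=; under eq_bigr do rewrite rotY_generatorX /= scalemx2 mulrN !factC.
by apply: mx2P; rewrite summxE !mxE /=; under eq_bigr do rewrite mxE /=;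
    rewrite ?sumrN rmorph_sum.
Qed.

Lemma rotYE (t : R) :
  rotY t = mx2 (cos (t / 2))%:C (- (sin (t / 2))%:C)
               (sin (t / 2))%:C (cos (t / 2))%:C.
Proof.
have cC : (fun n => (series (cos_coeff (t / 2)) n)%:C : complex_numField) @ \oo
    --> ((cos (t / 2))%:C : complex_numField).
  by rewrite cos.unlock; exact: cvg_real_complex (@is_cvg_series_cos_coeff R _).
have cS : (fun n => (series (sin_coeff (t / 2)) n)%:C : complex_numField) @ \oo
    --> ((sin (t / 2))%:C : complex_numField).
  by rewrite sin.unlock; exact: cvg_real_complex (@is_cvg_series_sin_coeff R _).
have cNS : (fun n => - (series (sin_coeff (t / 2)) n)%:C : complex_numField) @ \oo
   --> (- (sin (t / 2))%:C : complex_numField) by exact: cvgN.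
rewrite /rotY /expmx.
apply: (@cvg_lim 'M[complex_numField]_2).
  exact: (@norm_hausdorff complex_numField).
apply: (@cvg_mxE complex_numField) => i j.
rewrite !mxE; under eq_fun do rewrite rotY_seriesE !mxE.
by case: (i == ord0); case: (j == ord0); [exact: cC | exact: cNS | exact: cS | exact: cC].
Qed.
End Exponential.

(** * Majorana operators and Gaussian unitaries on one qubit *)

Lemma jw_string1 (R : realType) (P : 'M[R[i]]_2) (j : 'I_1) :
  jw_string P j = P :> 'M[R[i]]_2.
Proof.
rewrite (ord1 j); apply/matrixP => a b.
rewrite /jw_string castmxE /mxtens.ntensmx /= !mxE.
(* The outer tensor factors are identities of size 1: their indices always agree, which is [u1] and
   [v2], and the middle index is the original one, which is [v1]. *)
set u := fun k : 'I_2 => mxtens.mxtens_unindex (cast_ord (esym (@qubit_split 1 ord0)) k).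
have u1 k l : (u k).1 == (u l).1 by rewrite [X in X == _]ord1 [X in _ == X]ord1.
have v2 k l : (mxtens.mxtens_unindex (u k).2).2 == (mxtens.mxtens_unindex (u l).2).2.
  by apply/eqP; apply: val_inj; rewrite /= !modn1.
have v1 k : (mxtens.mxtens_unindex (u k).2).1 = k.
  by apply: val_inj; case: k => [[|[|[]]]].
rewrite -![mxtens.mxtens_unindex (cast_ord _ _)]/(u _) u1 v2 mul1r mulr1.
by congr (P _ _); exact: v1.
Qed.

Lemma majorana1_0 (R : realType) : @majorana R 1 ord0 = pauliX R.
Proof. exact: jw_string1. Qed.

Lemma majorana1_1 (R : realType) : @majorana R 1 ord_max = pauliY R.
Proof. exact: jw_string1. Qed.

(** The rows have norm 1, and so has the first column because the transpose is unitary too;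
    comparing them gives the moduli. *)
Lemma unitary2E (R : realType) (a b c d : R[i]) :
  mx2 a b c d \is unitarymx ->
  [/\ `|a| ^+ 2 + `|b| ^+ 2 = 1, `|c| = `|b| & `|d| = `|a|].
Proof.
move=> U; have /unitarymxP := U; rewrite adjmx2 mulmx2 scalarmx2.
rewrite -!normCK => e; have [ab _ _ cd] := mx2_inj e.
have /unitarymxP : (mx2 a b c d)^T \is unitarymx by rewrite trmx_unitary.
have -> : (mx2 a b c d)^T = mx2 a c b d by apply: mx2P; rewrite !mxE.
rewrite adjmx2 mulmx2 scalarmx2 -!normCK => e2; have [ac _ _ _] := mx2_inj e2.
have cb : `|c| ^+ 2 = `|b| ^+ 2 by apply: (addrI (`|a| ^+ 2)); rewrite ac ab.
split=> //; apply/eqP; rewrite -(eqrXn2 (n := 2)) ?normr_ge0 ?cb//.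
by apply/eqP; apply: (addrI (`|c| ^+ 2)); rewrite cd cb addrC ab.
Qed.

Lemma sum_majorana1 (R : realType) (x : 'I_2 -> R) :
  \sum_(k < 2 * 1) (x k)%:C *: @majorana R 1 k =
  mx2 0 (x ord0 -i* x ord_max) (x ord0 +i* x ord_max) 0.
Proof.
rewrite big_ord_recl big_ord1.
have -> : lift ord0 ord0 = ord_max :> 'I_2 by apply: val_inj.
rewrite majorana1_0 majorana1_1 pauliXE pauliYE !scalemx2 addmx2 -!complexiE.
by congr mx2; simpc.
Qed.

(** Combinations of X and Y have zero diagonal. Entry (0, 0) of the images of X and Y then forces a
    b = 0, so |a| + |b| and the norm of the row coincide. *)
Lemma gaussian1_row_norm (R : realType) (a b c d : R[i]) :
  @gaussian R 1 (mx2 a b c d) -> `|a| + `|b| = 1.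
Proof.
move=> [U [Q [_ HQ]]].
have := HQ ord0; have := HQ ord_max.
rewrite !sum_majorana1.
rewrite majorana1_0 majorana1_1 adjmx2 pauliXE pauliYE !mulmx2 -!complexiE.
rewrite !(mulr0, mulr1, add0r, addr0) => eY eX.
have [eY0 _ _ _] := mx2_inj eY; have [eX0 _ _ _] := mx2_inj eX.
have [ab1 _ _] := unitary2E U.
have i0 : 'i%C != 0 :> R[i] by rewrite complexiE neq0Ci.
have ab0 : a * (b^*)%R = 0.
  (* The terms in b a^* cancel in 'i times the equation for X minus the equation for Y. *)
  apply: (mulfI (x := 2%:R * 'i%C)); first by rewrite mulf_neq0 // pnatr_eq0.
  transitivity ('i%C * (b * (a^*)%R + a * (b^*)%R)
     - (b * 'i%C * (a^*)%R + a * - 'i%C * (b^*)%R)); first by ring.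
  by rewrite eX0 eY0 !mulr0 subr0.
have {}ab0 : a * b = 0.
  by move/eqP: ab0; rewrite mulf_eq0 conjC_eq0 -mulf_eq0 => /eqP.
apply/eqP; rewrite -(eqrXn2 (n := 2)) ?addr_ge0 //.
by rewrite sqrrD -normrM ab0 normr0 mul0rn addr0 expr1n ab1.
Qed.

(** The sign [e] is the determinant of the orthogonal matrix: diagonal unitaries act on the span of
    X and Y by rotations ([e] = 1), antidiagonal ones by reflections ([e] = -1). *)
Lemma gaussian1I (R : realType) (V : 'M[R[i]]_2) (w : R[i]) (e : R) :
  V \is unitarymx -> `|w| = 1 -> e ^+ 2 = 1 ->
  V *m pauliX R *m V ^t* = mx2 0 w (w^*)%R 0 ->
  V *m pauliY R *m V ^t* = e%:C *: mx2 0 (- 'i%C * w) ('i%C * (w^*)%R) 0 ->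
  @gaussian R 1 V.
Proof.
case: w => wr wi U w1 e1 eX eY; split=> //.
have ww : wr ^+ 2 + wi ^+ 2 = 1.
  by apply: (@complexI R); rewrite [LHS](add_Re2_Im2 (wr +i* wi)) w1 expr1n.
(* Entry (0, 1) of x X + y Y is x - 'i y, so w has coordinates (wr, -wi), and -'i w has coordinates
   (wi, wr). *)
exists (mx2 wr (- wi) (e * wi) (e * wr)); split.
  have -> : (mx2 wr (- wi) (e * wi) (e * wr))^T = mx2 wr (e * wi) (- wi) (e * wr).
    by apply: mx2P; rewrite !mxE.
  rewrite mulmx2 scalarmx2; congr mx2; [rewrite -ww | | |]; try by ring.
  by transitivity (e ^+ 2 * (wr ^+ 2 + wi ^+ 2)); [ring | rewrite e1 ww mulr1].
move=> k; rewrite sum_majorana1.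
have [->|->] : k = ord0 \/ k = ord_max.
  by case: k => [[|[|[]]]] //= ?; [left|right]; apply: val_inj.
  rewrite majorana1_0 eX !mxE /=; congr mx2; simpc => //.
rewrite majorana1_1 eY !mxE /= scalemx2; congr mx2; simpc => //.
Qed.

Lemma gaussian_diag (R : realType) (a d : R[i]) :
  `|a| = 1 -> `|d| = 1 -> @gaussian R 1 (mx2 a 0 0 d).
Proof.
move=> a1 d1; have nC (z : R[i]) : `|z| = 1 -> z * (z^*)%R = 1.
  by rewrite -normCK => ->; rewrite expr1n.
apply: (@gaussian1I _ _ (a * (d^*)%R) 1).
- apply/unitarymxP; rewrite adjmx2 mulmx2 scalarmx2.
  by rewrite !(rmorph0, mulr0, mul0r, addr0, add0r) !nC.
- by rewrite normrM norm_conjC a1 d1 mulr1.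
- by rewrite expr1n.
- rewrite pauliXE adjmx2 !mulmx2 rmorphM /= conjCK; congr mx2; rewrite ?rmorph0; ring.
- rewrite pauliYE adjmx2 !mulmx2 scale1r rmorphM /= conjCK -!complexiE.
  by congr mx2; rewrite ?rmorph0; ring.
Qed.

Lemma gaussian_antidiag (R : realType) (b c : R[i]) :
  `|b| = 1 -> `|c| = 1 -> @gaussian R 1 (mx2 0 b c 0).
Proof.
move=> b1 c1; have nC (z : R[i]) : `|z| = 1 -> z * (z^*)%R = 1.
  by rewrite -normCK => ->; rewrite expr1n.
apply: (@gaussian1I _ _ (b * (c^*)%R) (-1)).
- apply/unitarymxP; rewrite adjmx2 mulmx2 scalarmx2.
  by rewrite !(rmorph0, mulr0, mul0r, addr0, add0r) !nC.
- by rewrite normrM norm_conjC b1 c1 mulr1.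
- by rewrite sqrrN expr1n.
- rewrite pauliXE adjmx2 !mulmx2 rmorphM /= conjCK; congr mx2; rewrite ?rmorph0; ring.
- rewrite pauliYE adjmx2 !mulmx2 rmorphN1 scaleN1r rmorphM /= conjCK -!complexiE.
  rewrite -scaleN1r scalemx2; congr mx2; rewrite ?rmorph0; ring.
Qed.

(** * The extent of a one-qubit unitary *)

Lemma minimumE (R : realType) (A : set R) (x : R) :
  A x -> lbound A x -> minimum A = x.
Proof.
move=> Ax lbx; apply: xget_unique => // y [Ay lby].
by apply/eqP; rewrite eq_le lby // lbx.
Qed.

Lemma normC_normc (R : realType) (z : R[i]) : `|z| = (Normc.normc z)%:C.
Proof. by case: z. Qed.

Lemma unitary_extent1 (R : realType) (a b c d : R[i]) :
  mx2 a b c d \is unitarymx ->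
  @unitary_extent R 1 (mx2 a b c d) =
  1 + 2 * (Normc.normc a * Normc.normc b).
Proof.
move=> U; have [ab1 cb da] := unitary2E U.
have -> : 1 + 2 * (Normc.normc a * Normc.normc b) =
    (Normc.normc a + Normc.normc b) ^+ 2.
  have abR : Normc.normc a ^+ 2 + Normc.normc b ^+ 2 = 1.
    by apply: (@complexI R); rewrite rmorphD !rmorphXn /= -!normC_normc.
  by rewrite -[X in X + _]abR; ring.
(* The value 1 at 0 keeps the two matrices below unitary when an entry vanishes. *)
pose phase (z : R[i]) := if z == 0 then 1 else z / `|z|.
have phase1 z : `|phase z| = 1.
  rewrite /phase; case: eqP => [_|/eqP z0]; first exact: normr1.
  by rewrite normrM normfV normr_id divff // normr_eq0.
have phaseE z : `|z| * phase z = z.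
  rewrite /phase; case: eqP => [->|/eqP z0]; first by rewrite normr0 mul0r.
  by rewrite mulrCA divff ?mulr1 // normr_eq0.
have nn (z : R[i]) : 0 <= Normc.normc z by rewrite -ler0c -normC_normc.
apply: minimumE.
  (* The same weights serve the second row, since |d| = |a| and |c| = |b|. *)
  exists [:: (`|a|, mx2 (phase a) 0 0 (phase d));
             (`|b|, mx2 0 (phase b) (phase c) 0)].
    split.
      move=> x; rewrite !inE => /orP[] /eqP -> /=.
        by apply: gaussian_diag.
      by apply: gaussian_antidiag.
    rewrite big_cons big_seq1 /= !scalemx2 addmx2 !mulr0 !add0r !addr0.
    by rewrite -{2}da -{2}cb !phaseE.
  have norm_id z : Normc.normc `|z| = Normc.normc z :> R.
    by apply: (@complexI R); rewrite -!normC_normc normr_id.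
  by rewrite big_cons big_seq1 !norm_id.
move=> _ [D [DG UD] <-].
apply: lerXn2r; rewrite ?nnegrE ?addr_ge0 ?sumr_ge0 //.
rewrite -lecR rmorphD rmorph_sum /= -!normC_normc.
have entry i j : mx2 a b c d i j = \sum_(x <- D) x.1 * x.2 i j.
  by rewrite UD summxE; apply: eq_bigr => x _; rewrite mxE.
have -> : a = \sum_(x <- D) x.1 * x.2 ord0 ord0 by rewrite -entry mxE.
have -> : b = \sum_(x <- D) x.1 * x.2 ord0 ord_max by rewrite -entry mxE.
apply: le_trans (lerD (ler_norm_sum _ _ _) (ler_norm_sum _ _ _)) _.
(* After the triangle inequality the two sides are equal term by term, since the first row of each
   Gaussian unitary has moduli adding up to 1. *)
rewrite -big_split /= le_eqVlt; apply/orP; left; apply/eqP.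
rewrite big_seq [RHS]big_seq; apply: eq_bigr => x xD.
have := DG _ xD; rewrite (mx2E x.2) => /gaussian1_row_norm e.
by rewrite !mxE !normrM -mulrDr e mulr1 normC_normc.
Qed.

(** * Rotations and their mixtures as channels *)

(* The rotation by t with C = cos t, S = sin t; affine in (C, S), so that it
   also covers convex combinations of such rotations. *)
Definition rot_channel (R : realType) (C S : R[i]) (M : 'M[R[i]]_2) : 'M[R[i]]_2 :=
  let x := M ord0 ord0 in let y := M ord0 ord_max in
  let z := M ord_max ord0 in let w := M ord_max ord_max in
  2^-1 *: mx2 (x + w + (C * (x - w) - S * (y + z)))
              (y - z + (C * (y + z) + S * (x - w)))
              (z - y + (C * (y + z) + S * (x - w)))
              (x + w - (C * (x - w) - S * (y + z))).

Lemma cos_half_angle (R : realType) (t : R) :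
  cos t = cos (t / 2) ^+ 2 - sin (t / 2) ^+ 2.
Proof.
have e : t = (t / 2) *+ 2 by rewrite -mulr_natr divfK.
by rewrite {1}e cos_mulr2n -[X in _ *+ 2 - X](cos2Dsin2 (t / 2)); ring.
Qed.

Lemma sin_half_angle (R : realType) (t : R) :
  sin t = 2 * (cos (t / 2) * sin (t / 2)).
Proof.
have e : t = (t / 2) *+ 2 by rewrite -mulr_natr divfK.
by rewrite {1}e sin_mulr2n; ring.
Qed.

Lemma conj_channel_rotY (R : realType) (t : R) (M : 'M[R[i]]_2) :
  conj_channel (rotY t) M = rot_channel (cos t)%:C (sin t)%:C M.
Proof.
rewrite {1}(mx2E M) /rot_channel /conj_channel rotYE adjmx2 !mulmx2 scalemx2.
have cs1 := cos2Dsin2 (t / 2).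
rewrite (cos_half_angle t) (sin_half_angle t).
move: (cos _) (sin _) cs1 => c s cs1.
have cC : ((c%:C)^*)%R = c%:C := conjc_real c.
have sC : ((s%:C)^*)%R = s%:C := conjc_real s.
rewrite !rmorphN /= cC sC.
have {}cs1 : c%:C ^+ 2 + s%:C ^+ 2 = 1 :> R[i].
  by rewrite -!rmorphXn -rmorphD /= cs1.
rewrite !(rmorphB, rmorphM, rmorphXn) /= (rmorph_nat _ 2).
move: (M ord0 ord0) (M ord0 ord_max) (M ord_max ord0) (M ord_max ord_max) c%:C s%:C
  cs1 => x y z w C S e.
have two0 : 2 != 0 :> R[i] by rewrite pnatr_eq0.
(* Multiplying the terms free of C and S by C^2 + S^2 makes both sides homogeneous of degree 2 in C
   and S, so that [ring] applies. *)
have one u : (C ^+ 2 + S ^+ 2) * u = u by rewrite e mul1r.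
congr mx2; apply: (mulfI two0); rewrite [RHS]mulrA divff // mul1r.
- by rewrite -(one (x + w)); ring.
- by rewrite -(one (y - z)); ring.
- by rewrite -(one (z - y)); ring.
- by rewrite -(one (x + w)); ring.
Qed.

(** Up to a phase, Y is the rotation by pi, which changes the sign of both cosine and sine. *)
Lemma conj_channel_pauliY_rot (R : realType) (C S : R[i]) (M : 'M[R[i]]_2) :
  conj_channel (pauliY R) (rot_channel C S M) = rot_channel (- C) (- S) M.
Proof.
rewrite /rot_channel /conj_channel pauliYE adjmx2 !scalemx2 !mulmx2.
have ii : 'i%C * 'i%C = -1 :> R[i] by rewrite -expr2 sqr_i.
have -> : (('i%C : R[i])^*)%R = - 'i%C by rewrite complexiE conjCi.
rewrite rmorphN rmorph0 /=.
have -> : (('i%C : R[i])^*)%R = - 'i%C by rewrite complexiE conjCi.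
have f (u : R[i]) : 'i%C * u * 'i%C = - u by rewrite mulrAC ii mulN1r.
by congr mx2; rewrite !(mul0r, mulr0, add0r, addr0, mulrN, mulNr, opprK, f); ring.
Qed.

Lemma rot_channelD (R : realType) (a b C S C' S' : R[i]) (M : 'M[R[i]]_2) :
  a + b = 1 ->
  a *: rot_channel C S M + b *: rot_channel C' S' M =
  rot_channel (a * C + b * C') (a * S + b * S') M.
Proof.
move=> ab; rewrite /rot_channel !scalemx2 addmx2.
have -> : b = 1 - a by rewrite -ab; ring.
by congr mx2; ring.
Qed.

(** The error adds pi to the angle, so cosine and sine are both scaled by (1 - p) - p. *)
Lemma noisy_rotYE (R : realType) (theta p : R) (M : 'M[R[i]]_2) :
  noisy_rotY theta p M =
  rot_channel ((1 - 2 * p) * cos theta)%:C ((1 - 2 * p) * sin theta)%:C M.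
Proof.
rewrite /noisy_rotY conj_channel_rotY conj_channel_pauliY_rot rot_channelD.
  by congr rot_channel; rewrite mulrN -!rmorphM -rmorphB /=; congr _%:C; ring.
by rewrite -rmorphD subrK.
Qed.

(** The product of the rotation with its adjoint is the image of the identity under its channel, and
    [rot_channel] fixes the identity. *)
Lemma rotY_unitary (R : realType) (t : R) : rotY t \is unitarymx.
Proof.
have := conj_channel_rotY t 1%:M; rewrite /conj_channel mulmx1 => e.
apply/unitarymxP; rewrite e /rot_channel scalemx2 !mxE /= scalarmx2.
have two0 : 2 != 0 :> R[i] by rewrite pnatr_eq0.
rewrite !subrr !addr0 !mulr0 !subrr !addr0 !subr0 mulr0.
by rewrite -[1 + 1]/(2 : R[i]) mulVf.
Qed.

Lemma unitary_extent_rotY (R : realType) (t : R) :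
  @unitary_extent R 1 (rotY t) = 1 + `|sin t|.
Proof.
have := rotY_unitary t; rewrite rotYE => /unitary_extent1 ->.
congr (1 + _); rewrite (sin_half_angle t).
by rewrite !normrM normr_nat /Normc.normc /= oppr0 expr0n /= !addr0 sqrrN !sqrtr_sqr.
Qed.

(** * The lower bound on the cost of any decomposition *)

Lemma rot_channel_E00 (R : realType) (C S : R[i]) :
  rot_channel C S (mx2 1 0 0 0) ord0 ord_max = 2^-1 * S.
Proof. by rewrite /rot_channel !mxE /=; ring. Qed.

Lemma conj_channel_E00 (R : realType) (V : 'M[R[i]]_2) :
  conj_channel V (mx2 1 0 0 0) ord0 ord_max =
  V ord0 ord0 * (V ord_max ord0)^*%C.
Proof.
rewrite /conj_channel {1 2}(mx2E V) adjmx2 !mulmx2 mxE /=.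
by rewrite !(mulr0, mulr1, mul0r, addr0).
Qed.

Lemma normC_real (R : realType) (x : R) : `|x%:C| = `|x|%:C.
Proof. by rewrite normc_def /= expr0n addr0 sqrtr_sqr. Qed.

Lemma noisy_rotY_cost_ge (R : realType) (theta p : R) D :
  @unitary_decomposition R 1 (noisy_rotY theta p) D ->
  1 + `|1 - 2 * p| * `|sin theta| <= decomposition_cost D.
Proof.
move=> [DU D1 DE]; rewrite -normrM -[X in X + _]D1 /decomposition_cost.
(* The extent involves V_01 while the channel reveals V_10; unitarity makes their moduli equal. *)
have UE x : x \in D -> x.1 * unitary_extent x.2 = x.1 +
    2 * (x.1 * Normc.normc (x.2 ord0 ord0 * (x.2 ord_max ord0)^*%C)).
  move=> /DU[x0]; rewrite (mx2E x.2) => Ux; rewrite unitary_extent1 //.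
  have [_ cb _] := unitary2E Ux; rewrite !mxE /=.
  have -> : Normc.normc (x.2 ord0 ord_max) = Normc.normc ((x.2 ord_max ord0)^*%C).
    by apply: (@complexI R); rewrite -!normC_normc normcJ.
  by rewrite -Normc.normcM; ring.
rewrite big_seq [leRHS]big_seq (eq_bigr _ UE) -big_seq -[leRHS]big_seq.
rewrite big_split /= lerD2l -mulr_sumr.
pose w (V : 'M[R[i]]_2) := V ord0 ord0 * (V ord_max ord0)^*%C.
have qE : ((1 - 2 * p) * sin theta)%:C = 2 * \sum_(x <- D) x.1%:C * w x.2.
  have two0 : 2 != 0 :> R[i] by rewrite pnatr_eq0.
  have := congr1 (fun A : 'M[R[i]]_2 => A ord0 ord_max) (DE (mx2 1 0 0 0)).
  rewrite noisy_rotYE rot_channel_E00 summxE => e.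
  apply: (mulfI (invr_neq0 two0)); rewrite mulKf // e.
  by apply: eq_bigr => x _; rewrite mxE conj_channel_E00.
rewrite -lecR rmorphM rmorph_sum /= (rmorph_nat _ 2)
  -normC_real qE normrM normr_nat ler_wpM2l //.
apply: le_trans (ler_norm_sum _ _ _) _.
rewrite big_seq [leRHS]big_seq; apply: ler_sum => x /DU[x0 _].
by rewrite normrM normC_real (ger0_norm x0) normC_normc rmorphM.
Qed.

(** * The optimal mixture and the channel extent *)

(** The angles phi and pi - phi share their sine and have opposite cosines, so mixing them only
    scales the cosine, by s - (1 - s). *)
Lemma rotY_mixture (R : realType) (s phi : R) (M : 'M[R[i]]_2) :
  s%:C *: conj_channel (rotY phi) M +
    (1 - s)%:C *: conj_channel (rotY (pi - phi)) M =
  rot_channel ((2 * s - 1) * cos phi)%:C (sin phi)%:C M.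
Proof.
(* Rewriting would compare [rotY phi] with [rotY (pi - phi)] up to conversion,
   which unfolds the exponential. *)
have -> := congr2 (fun A B => s%:C *: A + (1 - s)%:C *: B)
  (conj_channel_rotY phi M) (conj_channel_rotY (pi - phi) M).
rewrite rot_channelD; last by rewrite -rmorphD addrC subrK.
have -> : sin (pi - phi) = sin phi by rewrite addrC sinDpi sinN opprK.
have -> : cos (pi - phi) = - cos phi by rewrite addrC cosDpi cosN.
by rewrite -!rmorphM -!rmorphD; congr rot_channel; congr _%:C; ring.
Qed.

Theorem lemma20 (R : realType) (theta p : R) (hp0 : 0 <= p) (hp1 : p <= 1) :
  let phi := asin ((1 - 2 * p) * sin theta) in
  let s := 2^-1 * (1 + (1 - 2 * p) * (cos theta / cos phi)) in
  let N := noisy_rotY theta p in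
  [/\ forall M, N M = s%:C *: conj_channel (rotY phi) M
                      + (1 - s)%:C *: conj_channel (rotY (pi - phi)) M,
      @optimal_decomposition R 1 N [:: (s, rotY phi); (1 - s, rotY (pi - phi))],
      @channel_extent R 1 N = 1 + `|sin phi|,
      @channel_extent R 1 N = 1 + `|1 - 2 * p| * `|sin theta|
    & p <= 2^-1 ->
      @channel_extent R 1 N = 1 + (1 - 2 * p) * `|sin theta|].
Proof.
move=> phi s N.
have p1 : `|1 - 2 * p| <= 1 by rewrite ler_norml; apply/andP; split; lra.
have p2 : (1 - 2 * p) ^+ 2 <= 1 by rewrite -real_normK ?num_real // exprn_ile1.
have qle : `|(1 - 2 * p) * sin theta| <= 1.
  by rewrite normrM mulr_ile1 // ler_norml sin_geN1 sin_le1.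
have sin_phi : sin phi = (1 - 2 * p) * sin theta.
  by rewrite asinK // in_itv /= -ler_norml.
have sin_piB : sin (pi - phi) = sin phi.
  by rewrite addrC sinDpi sinN opprK.
(* With q = 1 - 2p, this is q^2 cos^2 + q^2 sin^2 = q^2 <= 1, because cos phi ^+ 2 = 1 - q^2
   sin^2. *)
have cos_le : ((1 - 2 * p) * cos theta) ^+ 2 <= cos phi ^+ 2.
  rewrite cos2sin2 sin_phi lerBrDr !exprMn -mulrDr cos2Dsin2 mulr1 //.
(* If cos phi = 0, the quotient in [s] is 0 by convention and s = 1/2; the cosine to be matched is
   then 0 as well, so the decomposition still holds. *)
have cos_phi0 : cos phi = 0 -> (1 - 2 * p) * cos theta = 0.
  move=> c0; apply/eqP; rewrite -sqrf_eq0 eq_le sqr_ge0 andbT.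
  by move: cos_le; rewrite c0 expr0n.
have sE : (2 * s - 1) * cos phi = (1 - 2 * p) * cos theta.
  have -> : 2 * s - 1 = (1 - 2 * p) * (cos theta / cos phi).
    by rewrite /s mulrA divff ?pnatr_eq0 // mul1r addrAC subrr add0r.
  have [c0|c0] := eqVneq (cos phi) 0; first by rewrite cos_phi0 // c0 mulr0.
  by rewrite -!mulrA mulVf ?mulr1.
have NE M : N M = s%:C *: conj_channel (rotY phi) M
                      + (1 - s)%:C *: conj_channel (rotY (pi - phi)) M.
  by rewrite rotY_mixture sE sin_phi; exact: noisy_rotYE.
have s01 : 0 <= s <= 1.
  have : `|(1 - 2 * p) * (cos theta / cos phi)| <= 1.
    have [c0|c0] := eqVneq (cos phi) 0; first by rewrite c0 invr0 !mulr0 normr0.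
    rewrite mulrA normrM normfV ler_pdivrMr ?normr_gt0 // mul1r.
    by rewrite -ler_sqr ?nnegrE // !real_normK ?num_real.
  by rewrite ler_norml /s => /andP[? ?]; apply/andP; split; lra.
have ND : @unitary_decomposition R 1 N [:: (s, rotY phi); (1 - s, rotY (pi - phi))].
  split.
  - move=> x; rewrite !inE => /orP[] /eqP -> /=; split; try exact: rotY_unitary.
      by case/andP: s01.
    by rewrite subr_ge0; case/andP: s01.
  - by rewrite big_cons big_seq1 /= addrC subrK.
  - by move=> M; rewrite big_cons big_seq1 NE.
have costE : @decomposition_cost R 1 [:: (s, rotY phi); (1 - s, rotY (pi - phi))]
    = 1 + `|1 - 2 * p| * `|sin theta|.
  rewrite /decomposition_cost big_cons big_seq1 /=.
  (* Both rotations have the same extent, so the weight s drops out. As in [rotY_mixture], [congr2]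
     avoids comparing the two rotations by conversion. *)
  have -> := congr2 (fun A B => s * A + (1 - s) * B)
    (unitary_extent_rotY phi) (unitary_extent_rotY (pi - phi)).
  by rewrite sin_piB -mulrDl addrC subrK mul1r sin_phi normrM.
have extE : @channel_extent R 1 N = 1 + `|1 - 2 * p| * `|sin theta|.
  apply: minimumE; first by exists [:: (s, rotY phi); (1 - s, rotY (pi - phi))].
  by move=> _ [D ND' <-]; exact: noisy_rotY_cost_ge.
split=> //.
- by split=> // D' ND'; rewrite costE; exact: noisy_rotY_cost_ge.
- by rewrite extE sin_phi normrM.
(* For p <= 1/2 the factor 1 - 2p is nonnegative and equals its absolute value. *)
- by move=> p12; rewrite extE [`|1 - _|]ger0_norm //; lra.
Qed.
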